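(* For any $(D,N,R)\in\mathbb Z^3$ with $D>0$, $N>1$, $R>0$, a $\mathrm{TFF}(D,N,R)$ exists if and only if either $f(D,N,R):=DNR-D^2-NR^2\ge0$ or there exists $(D_0,N,R_0)\in\operatorname{Orb}(D,N,R)$ with $0<R_0\in\{\frac{D_0}N,D_0\}$. Moreover, if a $\mathrm{TFF}(D,N,R)$ exists then a real $\mathrm{TFF}(D,N,R)$ exists.
   Context: Orbits. Let $\nu,\sigma:\mathbb R^3\to\mathbb R^3$ be the involutions $\nu(D,N,R):=(NR-D,N,R)$ and $\sigma(D,N,R):=(D,N,D-R)$. For $(D,N,R)\in\mathbb Z^3$ with $N>1$, $\operatorname{Orb}(D,N,R)$ denotes the orbit of $(D,N,R)$ under the action of the group generated by $\nu$ and $\sigma$. Tight fusion frames. Let $D,N,R$ be positive integers with $N>1$. A $\mathrm{TFF}(D,N,R)$ is a sequence $\{\mathcal U_n\}_{n=1}^N$ of $R$-dimensional subspaces of a $D$-dimensional complex Hilbert space $\mathcal H$ whose orthogonal projections $\mathbf P_n$ satisfy $\sum_{n=1}^N\mathbf P_n=A\mathbf I$ for some $A>0$. It is real if there is a unitary $\mathbf U:\mathbb C^D\to\mathcal H$ such that every matrix $\mathbf U^*\mathbf P_n\mathbf U$ has all real entries; equivalently, it can be realized in $\mathbb R^D$. *)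

(* Defs.v *)
From mathcomp Require Import all_boot all_order all_algebra.
From mathcomp Require Import complex reals.

Set Implicit Arguments.
Unset Strict Implicit.
Unset Printing Implicit Defensive.

Import Order.TTheory GRing.Theory Num.Theory.

Local Open Scope ring_scope.

Section Orbits.

Inductive generated_group (T : Type) (S : (T -> T) -> Prop) :
    (T -> T) -> Prop :=
| gen_incl g : S g -> generated_group S g
| gen_id : generated_group S id
| gen_comp g h :
    generated_group S g -> generated_group S h -> generated_group S (g \o h)
| gen_inv g h :
    generated_group S g -> cancel g h -> cancel h g -> generated_group S h.

Variable K : realType.
Implicit Types x y : K * K * K.

Definition nu x := let: (D, N, R) := x in (N * R - D, N, R).

Definition sigma x := let: (D, N, R) := x in (D, N, D - R).

Definition Orb x y : Prop :=
  exists2 g, generated_group (fun s => s = nu \/ s = sigma) g & y = g x.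

End Orbits.

Section TightFusionFrames.

Variable K : realType.

(* A [D]-dimensional complex Hilbert space is a [H : vectType K[i]] of
   dimension [D] with a positive definite Hermitian form; completeness is
   automatic in finite dimension. The forms of the library are linear in
   their first argument and conjugate-linear in the second. *)
Section Hilbert.

Variables (H : vectType K[i]) (form : {dot H for Num.conj}).

(* [daddv_pi V W] is the projection onto [V] along [W]. *)
Definition orthoproj (V : {vspace H}) : 'End(H) :=
  daddv_pi V (orthov form V).

Definition is_TFF (D N R : nat) (U : 'I_N -> {vspace H}) : Prop :=
  [/\ \dim {:H} = D,
      forall n, \dim (U n) = R &
      exists2 A : K, 0 < A & \sum_(n < N) orthoproj (U n) = A%:C%C *: \1%VF].

(* [dotmx] is the standard inner product of C^D, seen as row vectors. *)
Definition is_unitary_map (D : nat) (W : 'Hom('rV[K[i]]_D, H)) : Prop :=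
  isometry form (@dotmx _ D) W /\ limg W = fullv.

(* The inverse of a unitary map is its adjoint. As [lin1_mx] acts on row
   vectors, it yields the transpose of the usual matrix of an operator, which
   has the same entries. *)
Definition is_real_TFF (D N R : nat) (U : 'I_N -> {vspace H}) : Prop :=
  is_TFF D R U /\
  exists2 W : 'Hom('rV[K[i]]_D, H), is_unitary_map W &
    forall n, lin1_mx (W^-1 \o orthoproj (U n) \o W)%VF \is a mxOver Num.real.

End Hilbert.

Definition TFF_exists (D N R : nat) : Prop :=
  exists (H : vectType K[i]) (form : {dot H for Num.conj})
    (U : 'I_N -> {vspace H}), is_TFF form D R U.

Definition real_TFF_exists (D N R : nat) : Prop :=
  exists (H : vectType K[i]) (form : {dot H for Num.conj})
    (U : 'I_N -> {vspace H}), is_real_TFF form D R U.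

End TightFusionFrames.

Definition ftff (D N R : int) : int := D * N * R - D ^+ 2 - N * R ^+ 2.

(* Main.v *)
(* A TFF(D,N,R) is encoded by R x D matrices V_n with orthonormal rows such that
   sum_n V_n^* V_n is the scalar NR/D. Complementing every subspace gives a
   TFF(D,N,D-R), and complementing the row space of the stacked synthesis matrix
   (Naimark) gives a TFF(NR-D,N,R). Since 2f = D(NR-2D) + NR(D-2R), as long as
   f < 0 one of these two moves decreases D+R, until R = D or D = NR. When
   f >= 0 the same descent stops at 2R <= D <= NR/2, where the spectral tetris
   construction applies. Complex frames reduce to real ones by realification,
   which doubles D and R; this is harmless for necessity because f and the
   orbits are homogeneous in (D,R). *)

Require Import Defs.
From mathcomp Require Import all_boot all_order all_algebra.
From mathcomp Require Import complex reals.
From mathcomp Require Import zify ring lra.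

Import Order.TTheory GRing.Theory Num.Theory.

Local Open Scope ring_scope.

(** * Matrix model and complements *)

(** The matrices are real from the outset; complex frames enter only through realification. Traces
    force the constant to be NR/D, and its denominator is cleared. *)
Definition orthonormal_frames (K : realType) (D N R : nat) : Prop :=
  exists V : 'I_N -> 'M[K]_(R, D),
    (forall n, V n *m (V n)^T = 1%:M) /\
    D%:R *: (\sum_n (V n)^T *m V n) = (N * R)%:R%:M.

(** This trace is the sum of the squares of the entries. *)
Lemma mxtrace_mul_tr_eq0 (K : realType) m n (A : 'M[K]_(m, n)) :
  \tr (A *m A^T) = 0 -> A = 0.
Proof.
move=> trA; apply/matrixP => i j; rewrite mxE.
have sq_ge0 i' j' : 0 <= A i' j' * A^T j' i' by rewrite mxE -expr2 sqr_ge0.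
have row_ge0 i' : 0 <= (A *m A^T) i' i' by rewrite mxE sumr_ge0.
have := @psumr_eq0P _ _ xpredT _ (fun i' _ => row_ge0 i') trA i isT.
move=> /eqP; rewrite mxE psumr_eq0 //.
move=> /allP /(_ j (mem_index_enum j)) /eqP/eqP.
by rewrite mxE mulf_eq0 orbb => /eqP.
Qed.

(** Induction on the rank, read off as the trace: a unit row [v] fixed by [P] is split off, and
    [P - v^T *m v] is again a symmetric idempotent, of trace one less. *)
Lemma symmetric_idempotent_factor (K : realType) n r (P : 'M[K]_n) :
  P^T = P -> P *m P = P -> \tr P = r%:R ->
  exists2 V : 'M[K]_(r, n), V *m V^T = 1%:M & P = V^T *m V.
Proof.
elim: r P => [|r IHr] P symP idP trP.
  have P0 : P = 0 by apply: mxtrace_mul_tr_eq0; rewrite symP idP.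
  by exists 0; [apply/matrixP => - [] | rewrite mulmx0].
have /rowV0Pn[x /submxP[y xE] x_neq0] : P != 0.
  by apply/eqP => P0; move/eqP: trP; rewrite P0 mxtrace0 eq_sym pnatr_eq0.
have xP : x *m P = x by rewrite xE -mulmxA idP.
pose s := (x *m x^T) 0 0.
have xxT : x *m x^T = s%:M by rewrite -mx11_scalar.
have s_gt0 : 0 < s.
  rewrite lt_neqAle /s mxE sumr_ge0 ?andbT; last first.
    by move=> i _; rewrite mxE -expr2 sqr_ge0.
  apply: contraNneq x_neq0 => s0; apply/eqP/mxtrace_mul_tr_eq0.
  by rewrite /mxtrace big_ord1 mxE -s0.
pose v := (Num.sqrt s)^-1 *: x.
have vP : v *m P = v by rewrite /v -scalemxAl xP.
have PvT : P *m v^T = v^T by rewrite -[in LHS]symP -trmx_mul vP.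
have vvT : v *m v^T = 1%:M.
  rewrite /v linearZ /= -scalemxAl -scalemxAr xxT scalerA -invfM -expr2.
  by rewrite sqr_sqrtr ?ltW // scale_scalar_mx mulVf ?gt_eqF.
pose Q := P - v^T *m v.
have Qv : Q *m v^T = 0 by rewrite mulmxBl PvT -mulmxA vvT mulmx1 subrr.
have [|||V VVT QE] := IHr Q.
- by rewrite /Q linearB /= symP trmx_mul trmxK.
- by rewrite {2}/Q mulmxBr mulmxA Qv mul0mx subr0 /Q mulmxBl idP -mulmxA vP.
- rewrite /Q linearB /= trP mxtrace_mulC vvT mxtrace1.
  by rewrite -[r.+1]addn1 natrD addrK.
have VvT : V *m v^T = 0.
  by rewrite -[V]mul1mx -VVT -!mulmxA (mulmxA V^T) -QE Qv mulmx0.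
have VP : (col_mx v V)^T *m col_mx v V = P.
  by rewrite tr_col_mx mul_row_col -QE /Q addrC subrK.
have VV : col_mx v V *m (col_mx v V)^T = 1%:M.
  rewrite tr_col_mx mul_col_row vvT VVT VvT.
  by rewrite -[v *m _]trmxK trmx_mul trmxK VvT trmx0 -scalar_mx_block.
by exists (col_mx v V).
Qed.

(** Both complements have explicit projections but no explicit orthonormal rows. *)
Lemma orthonormal_frames_of_projections (K : realType) (D N R : nat)
    (P : 'I_N -> 'M[K]_D) :
  (forall n, [/\ (P n)^T = P n, P n *m P n = P n & \tr (P n) = R%:R]) ->
  D%:R *: (\sum_n P n) = (N * R)%:R%:M -> orthonormal_frames K D N R.
Proof.
move=> projP sumP.
have factor n : exists2 V : 'M[K]_(R, D), V *m V^T = 1%:M & P n = V^T *m V.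
  by case: (projP n); apply: symmetric_idempotent_factor.
have [V VVT PE] := fin_all_exists2 factor.
by exists V; split=> //; under eq_bigr do rewrite -PE.
Qed.

Section Complements.
Variables (K : realType) (N : nat).

(** Each [V n] has a right inverse, and the stacked matrix [W] has a left inverse by tightness. *)
Lemma orthonormal_frames_leq D R :
  orthonormal_frames K D N R -> (0 < N)%N -> (0 < R)%N ->
  (R <= D <= N * R)%N.
Proof.
move=> [V [VVT sumV]] N_gt0 R_gt0; apply/andP; split.
  by have := mulmx1_min (VVT (Ordinal N_gt0)).
pose W := \mxcol_(n < N) V n.
have WTW : ((N * R)%:R^-1 * D%:R *: W^T) *m W = 1%:M.
  rewrite -scalemxAl tr_mxcol mul_mxrow_mxcol -scalerA sumV scale_scalar_mx.
  by rewrite mulVf // pnatr_eq0 muln_eq0 negb_or -!lt0n N_gt0 R_gt0.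
by have := mulmx1_min WTW; rewrite sum_nat_const card_ord.
Qed.

Lemma orthonormal_frames_sigma D R :
  (R < D)%N -> orthonormal_frames K D N R -> orthonormal_frames K D N (D - R).
Proof.
move=> /ltnW leRD [V [VVT sumV]].
apply: (orthonormal_frames_of_projections _ _ _ _
  (fun n => 1%:M - (V n)^T *m V n)) => [n|].
  split.
  - by rewrite linearB /= trmx1 trmx_mul trmxK.
  - rewrite mulmxBr mulmx1 mulmxBl mul1mx mulmxA -(mulmxA (V n)^T) VVT mulmx1.
    by rewrite subrr subr0.
  - by rewrite linearB /= mxtrace1 mxtrace_mulC VVT mxtrace1 natrB.
rewrite sumrB sumr_const card_ord scalerBr sumV -scaler_nat !scale_scalar_mx.
rewrite mulr1 -natrM mulnC -raddfB /= -natrB ?leq_mul2l ?leRD ?orbT //.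
by rewrite -mulnBr.
Qed.

(* The Naimark complement: the synthesis matrix of the frame is, up to scale, a
   coisometry, and its row space complement provides the complementary one. *)
Lemma orthonormal_frames_nu D R : (0 < D)%N -> (0 < N)%N -> (0 < R)%N ->
  (D < N * R)%N ->
  orthonormal_frames K D N R -> orthonormal_frames K (N * R - D) N R.
Proof.
move=> D_gt0 N_gt0 R_gt0 ltD [V [VVT sumV]].
(* Tightness reads [W^T *m W = c^-1%:M], so [c *: (W *m W^T)] is a projection of rank D. *)
pose c : K := D%:R / (N * R)%:R.
have NR_neq0 : (N * R)%:R != 0 :> K.
  by rewrite pnatr_eq0 muln_eq0 negb_or -!lt0n N_gt0 R_gt0.
have c1_neq0 : 1 - c != 0.
  rewrite subr_eq0 eq_sym -(inj_eq (mulIf NR_neq0)) mul1r divfK //.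
  by rewrite eqr_nat ltn_eqF.
have cE : 1 - c = (N * R - D)%:R / (N * R)%:R.
  by rewrite natrB ?(ltnW ltD) // mulrBl divff.
pose W := \mxcol_(n < N) V n.
have c_neq0 : c != 0.
  by rewrite mulf_neq0 ?invr_eq0 // pnatr_eq0 -lt0n.
have WTW : W^T *m W = c^-1%:M.
  rewrite tr_mxcol mul_mxrow_mxcol invfM invrK -scale_scalar_mx -sumV scalerA.
  by rewrite mulVf ?scale1r // pnatr_eq0 -lt0n.
have [|||X XXT QE] := symmetric_idempotent_factor K _ (N * R - D)
  (1%:M - c *: (W *m W^T)).
- by rewrite linearB linearZ /= trmx1 trmx_mul trmxK.
- rewrite mulmxBr mulmx1 mulmxBl mul1mx -scalemxAr -scalemxAl mulmxA.
  rewrite -(mulmxA W) WTW mul_mx_scalar -scalemxAl [c *: (c^-1 *: _)]scalerA.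
  by rewrite divff // scale1r subrr subr0.
- rewrite linearB linearZ /= mxtrace1 mxtrace_mulC WTW mxtrace_scalar mulrnAr.
  by rewrite divff // natrB ?(ltnW ltD) // sum_nat_const card_ord.
(* The n-th diagonal block of the complementary projection is [(1 - c)%:M], because [V n] has
   orthonormal rows. So [Y n] is an isometry up to the factor sqrt(1 - c), and its range is the n-th
   new subspace. *)
pose Y n := submxrow X n.
have YTY n : (Y n)^T *m Y n = (1 - c)%:M.
  have -> : (1 - c)%:M = submxblock (1%:M - c *: (W *m W^T)) n n.
    have WWT : submxblock (W *m W^T) n n = 1%:M.
      by rewrite tr_mxcol mul_mxcol_mxrow mxblockK VVT.
    rewrite submxblockB [submxblock (c *: _) n n]linearZ /=.
    rewrite -/(submxblock _ n n).
    rewrite WWT scale_scalar_mx mulr1 raddfB /=.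
    congr (_ - _); apply/matrixP => i j; rewrite !mxE.
    by rewrite -[tagnat.Rank _ _ == _]val_eqE tagnat.eq_Rank /= eqxx.
  by rewrite QE submxblockEh -mul_submxrow -submxcol_mul -tr_submxrow.
apply: (orthonormal_frames_of_projections _ _ _ _
  (fun n => (1 - c)^-1 *: (Y n *m (Y n)^T))) => [n|].
  split.
  - by rewrite linearZ /= trmx_mul trmxK.
  - rewrite -scalemxAl -scalemxAr mulmxA -(mulmxA (Y n)) YTY mul_mx_scalar.
    by rewrite -scalemxAl [X in _ *: X]scalerA mulVf // scale1r.
  - by rewrite mxtraceZ mxtrace_mulC YTY mxtrace_scalar mulrnAr mulVf.
rewrite -scaler_sumr.
have -> : \sum_n Y n *m (Y n)^T = 1%:M.
  by rewrite -XXT -[in RHS](submxrowK X) tr_mxrow mul_mxrow_mxcol.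
rewrite !scale_scalar_mx mulr1 cE invfM invrK mulrA divff ?mul1r //.
by rewrite pnatr_eq0 -lt0n subn_gt0.
Qed.
End Complements.

(** * Spectral tetris *)

(** Vector [j] is assigned to subspace [j] mod N, so distinct vectors of one subspace have indices
    at least N apart; disjoint supports make them orthogonal. *)
Lemma orthonormal_frames_of_rows (K : realType) D N R (w : nat -> nat -> K) :
  (forall j, (j < N * R)%N -> \sum_(i < D) w j i ^+ 2 = 1) ->
  (forall j j' i, (j + N <= j')%N -> (j' < N * R)%N -> w j i * w j' i = 0) ->
  (forall i i' : 'I_D,
     D%:R * (\sum_(0 <= j < N * R) w j i * w j i') = (N * R)%:R *+ (i == i')) ->
  orthonormal_frames K D N R.
Proof.
move=> w1 w0 wsum; exists (fun n => \matrix_(t, i) w (n + t * N)%N i).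
have lt_idx (n : 'I_N) (t : 'I_R) : (n + t * N < N * R)%N.
  apply: (@leq_trans (t.+1 * N)); first by rewrite mulSn ltn_add2r.
  by rewrite mulnC leq_mul2l ltn_ord orbT.
split=> [n|].
  apply/matrixP => t t'; rewrite !mxE.
  case: (ltngtP t t') => [lt_tt'|lt_tt'|/val_inj ->]; last first.
  - rewrite eqxx -[RHS](w1 _ (lt_idx n t')).
    by apply: eq_bigr => i _; rewrite !mxE.
  - rewrite -val_eqE gtn_eqF // big1 // => i _; rewrite !mxE mulrC w0 //.
    by have := ltn_ord n; nia.
  - rewrite -val_eqE ltn_eqF // big1 // => i _; rewrite !mxE w0 //.
    by have := ltn_ord n; nia.
apply/matrixP => i i'; rewrite !mxE summxE -wsum; congr (_ * _).
under eq_bigr do rewrite mxE; rewrite exchange_big mulnC big_nat_mul big_mkord.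
apply: eq_bigr => t _.
rewrite mulSn -{1}[(t * N)%N]add0n big_addn addnK big_mkord.
by apply: eq_bigr => n _; rewrite !mxE.
Qed.

Lemma orthonormal_frames_full (K : realType) D N :
  orthonormal_frames K D N D.
Proof.
exists (fun=> 1%:M); split=> [n|]; first by rewrite mul1mx trmx1.
under eq_bigr do rewrite trmx1 mulmx1.
by rewrite sumr_const card_ord -scaler_nat !scale_scalar_mx mulr1 -natrM mulnC.
Qed.

Lemma orthonormal_frames_basis (K : realType) N R :
  orthonormal_frames K (N * R) N R.
Proof.
apply: (orthonormal_frames_of_rows _ _ _ _ (fun j i => (j == i)%:R)).
- move=> j ltj; rewrite (bigD1 (Ordinal ltj)) //= eqxx expr1n big1 ?addr0 //.
  by move=> i; rewrite -val_eqE eq_sym => /negPf /= ->; rewrite expr0n.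
- move=> j j' i le_jj' ltj'; case: (j =P i) => [ij|_]; last by rewrite mul0r.
  by case: (j' =P i) => [ij'|_]; rewrite ?mulr0 //; exfalso; have := ltj'; nia.
move=> i i'; rewrite big_mkord (bigD1 i) //= eqxx mul1r big1 ?addr0.
  by rewrite mulr_natr.
by move=> j; rewrite -val_eqE => /negPf /= ->; rewrite mul0r.
Qed.

Section SpectralTetris.
Variables (K : realType) (D N R : nat).
Hypotheses (D_gt0 : (0 < D)%N) (le_2R_D : (2 * R <= D)%N)
  (le_2D_NR : (2 * D <= N * R)%N).

(* Row [d] of the tight frame carries the weight of the interval
   [[d NR/D, (d+1) NR/D]]. Block [d] consists of the vectors [j] with
   [start d <= j < start d.+1]. The first two of them straddle rows [d.-1] and
   [d], splitting their weight 2 as [overlap d] and [2 - overlap d], with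
   opposite signs so that the cross terms cancel; the others are basis
   vectors. *)
Let start d := ((d * (N * R)) %/ D)%N.
Let overlap d : K := ((d * (N * R)) %% D)%:R / D%:R.
Let block j := ((D * j.+1).-1 %/ (N * R))%N.

Definition tetris j i : K :=
  let d := block j in
  if (i == d) then
    if j == start d then Num.sqrt (1 - overlap d / 2)
    else if j == (start d).+1 then - Num.sqrt (1 - overlap d / 2) else 1
  else if (i.+1 == d) && (j <= (start d).+1)%N then Num.sqrt (overlap d / 2)
  else 0.

Let NR_gt0 : (0 < N * R)%N. Proof. by lia. Qed.

Lemma start_overlap d : (start d)%:R + overlap d = d%:R * ((N * R)%:R / D%:R).
Proof.
rewrite mulrA -natrM [in RHS](divn_eq (d * (N * R)) D) natrD natrM mulrDl.
rewrite mulfK //.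
by rewrite pnatr_eq0 -lt0n.
Qed.

Lemma start_bounds d :
  (D * start d <= d * (N * R) < D * (start d).+1)%N.
Proof. by rewrite ![(D * _)%N]mulnC leq_divM ltn_ceil. Qed.

(** Since NR/D is at least 2, every block has room for its two straddling vectors. *)
Lemma startS d : ((start d).+2 <= start d.+1)%N.
Proof.
by rewrite leq_divRL // ; have := start_bounds d; nia.
Qed.

(** The predecessor in [block] turns a weak inequality into a strict one: [j < start e] means D(j+1)
    <= e NR, that is, D(j+1) - 1 < e NR. *)
Lemma block_eq d j : (block j == d) = (start d <= j < start d.+1)%N.
Proof.
have lt_start e : (j < start e)%N = (block j < e)%N.
  by rewrite leq_divRL // ltn_divLR //; nia.
by rewrite leqNgt !lt_start; lia.
Qed.

Lemma overlap_itv d : 0 <= overlap d < 1.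
Proof.
by rewrite divr_ge0 // ltr_pdivrMr ?ltr0n // mul1r ltr_nat ltn_mod.
Qed.

Lemma block_start d : block (start d) = d.
Proof. by apply/eqP; rewrite block_eq leqnn (leq_trans _ (startS d)). Qed.

Lemma block_start1 d : block (start d).+1 = d.
Proof. by apply/eqP; rewrite block_eq leqnSn startS. Qed.

Lemma overlap0 : overlap 0 = 0.
Proof. by rewrite /overlap mul0n mod0n mul0r. Qed.

Lemma sqr_main d : Num.sqrt (1 - overlap d / 2) ^+ 2 = 1 - overlap d / 2.
Proof.
rewrite sqr_sqrtr //; case/andP: (overlap_itv d).
by move: (overlap d) => x x0 x1; lra.
Qed.

Lemma sqr_side d : Num.sqrt (overlap d / 2) ^+ 2 = overlap d / 2.
Proof.
rewrite sqr_sqrtr //; case/andP: (overlap_itv d).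
by move: (overlap d) => x x0 x1; lra.
Qed.

Lemma tetris_start d i : tetris (start d) i =
  if i == d then Num.sqrt (1 - overlap d / 2)
  else if i.+1 == d then Num.sqrt (overlap d / 2) else 0.
Proof. by rewrite /tetris block_start eqxx leqnSn andbT. Qed.

Lemma tetris_start1 d i : tetris (start d).+1 i =
  if i == d then - Num.sqrt (1 - overlap d / 2)
  else if i.+1 == d then Num.sqrt (overlap d / 2) else 0.
Proof.
by rewrite /tetris block_start1 eqxx leqnn andbT [_.+1 == start d]gtn_eqF.
Qed.

Lemma tetris_free d j i : ((start d).+2 <= j < start d.+1)%N ->
  tetris j i = (i == d)%:R.
Proof.
move=> /andP[ltdj ltjd]; have /eqP bj : block j == d.
  by rewrite block_eq ltjd (leq_trans _ ltdj) // ltnW.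
rewrite /tetris bj [j == start d]gtn_eqF ?(ltnW ltdj) // [j == _.+1]gtn_eqF //.
rewrite [(j <= _)%N]leqNgt ltdj andbF.
by case: eqP.
Qed.

(** With x = [overlap d], the straddling pair gives 2(1 - x/2) = 2 - x to row d and x to row d-1,
    its opposite signs cancelling the cross terms; each other vector of the block gives 1 to row
    d. *)
Lemma sum_block d i i' :
  \sum_(start d <= j < start d.+1) tetris j i * tetris j i' =
  ((start d.+1)%:R - (start d)%:R - overlap d) *+ ((i == i') && (i == d))
  + overlap d *+ ((i == i') && (i.+1 == d)).
Proof.
have le_start := startS d.
rewrite big_ltn ?(leq_trans _ le_start) // big_ltn //.
rewrite !tetris_start !tetris_start1.
under eq_big_nat => j dj do rewrite !(tetris_free _ _ _ dj).
rewrite sumr_const_nat -[in (start d.+1)%:R](subnK le_start) natrD.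
rewrite !mulrb.
move: (Num.sqrt (1 - _)) (sqr_main d) (Num.sqrt _) (sqr_side d) => a a2 b b2.
have [->|id] := eqVneq i d.
  rewrite [d.+1 == d]gtn_eqF // andbF andbT [d == i']eq_sym.
  have [_|_] := eqVneq i' d.
    by rewrite /= mulrNN !mulr1 -!expr2 a2; field.
  by rewrite mul1r mul0rn; case: ifP => _; ring.
rewrite andbF andbC.
have [id1|id1] := eqVneq i.+1 d; last by rewrite /= !mul0r mul0rn !addr0.
rewrite -{}id1 in b2 *.
rewrite [i' == i.+1]eq_sym eqSS /= [i' == i]eq_sym.
have [<-|_] := eqVneq i i'.
  by rewrite gtn_eqF // mul0r mul0rn -!expr2 b2; field.
by case: ifP => _; rewrite ?mul0r ?mulr0 mul0rn; ring.
Qed.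

Lemma sum_tetris (i i' : 'I_D) :
  D%:R * (\sum_(0 <= j < N * R) tetris j i * tetris j i') =
  (N * R)%:R *+ (i == i').
Proof.
have sum_start n (F : nat -> K) :
    \sum_(0 <= j < start n) F j =
    \sum_(d < n) \sum_(start d <= j < start d.+1) F j.
  elim: n => [|n IHn]; first by rewrite big_ord0 /start mul0n div0n big_geq.
  rewrite big_ord_recr /= -IHn -big_cat_nat // (leq_trans _ (startS n)) //.
  by rewrite -addn2 leq_addr.
have {1}-> : (N * R = start D)%N by rewrite /start mulKn.
rewrite sum_start; under eq_bigr do rewrite sum_block.
rewrite big_split /= (bigD1 i) //= eqxx andbT big1 ?addr0; last first.
  by move=> d; rewrite -val_eqE eq_sym => /negPf ->; rewrite andbF.
have -> : \sum_(d < D) overlap d *+ ((i == i' :> nat) && (i.+1 == d)) =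
          overlap i.+1 *+ (i == i').
  case: (ltnP i.+1 D) => [ltiD|leDi].
    rewrite (bigD1 (Ordinal ltiD)) //= eqxx andbT big1 ?addr0 //.
    by move=> d; rewrite -val_eqE eq_sym => /negPf /= ->; rewrite andbF.
  (* The last row has no following block, which is consistent since [overlap D] is 0. *)
  have -> : i.+1 = D by apply/eqP; rewrite eqn_leq leDi ltn_ord.
  rewrite /overlap modnMr mul0r mul0rn big1 // => d _.
  by rewrite [D == d]gtn_eqF ?andbF.
rewrite -mulrnDl mulrnAr; congr (_ *+ _).
(* Row i receives the difference of (i+1)NR/D and i NR/D. *)
have := start_overlap i; have := start_overlap i.+1.
set k' := (start i.+1)%:R; set k := (start i)%:R; set q := _ / _ => eq' eq.
have -> : k' - k - overlap i + overlap i.+1 = q.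
  by move: eq' eq; rewrite -natr1; lra.
by rewrite /q mulrC divfK // pnatr_eq0 -lt0n.
Qed.

Lemma sum_sqr_tetris j : (j < N * R)%N -> \sum_(i < D) tetris j i ^+ 2 = 1.
Proof.
move=> ltj; pose d := block j.
have ltdD : (d < D)%N by rewrite ltn_divLR //; nia.
(* Vector [j] has squared weight x/2 in row d-1, which is 0 unless it straddles. *)
pose x : K := if (j <= (start d).+1)%N then overlap d else 0.
have sqrE i :
    tetris j i ^+ 2 = (1 - x / 2) *+ (i == d) + (x / 2) *+ (i.+1 == d).
  rewrite /tetris -/d /x !mulrb.
  have [->|id] := eqVneq i d.
    rewrite [d.+1 == d]gtn_eqF // addr0.
    have [->|j0] := eqVneq j (start d); first by rewrite leqnSn sqr_main.
    have [->|j1] := eqVneq j (start d).+1.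
      by rewrite leqnn sqrrN sqr_main.
    have /andP[ledj _] : (start d <= j < start d.+1)%N by rewrite -block_eq.
    rewrite leqNgt ltn_neqAle eq_sym j1 ltn_neqAle eq_sym j0 ledj /=.
    by rewrite mul0r subr0 expr1n.
  have [i1|i1] := eqVneq i.+1 d; last by rewrite expr0n addr0.
  by rewrite /=; case: ifP => _; rewrite ?sqr_side ?expr0n ?mul0r !add0r.
under eq_bigr do rewrite sqrE.
rewrite big_split /= (bigD1 (Ordinal ltdD)) //= eqxx big1 ?addr0; last first.
  by move=> i; rewrite -val_eqE => /negPf /= ->.
(* Block 0 has no preceding row, but its overlap vanishes. *)
case dE: d => [|e].
  rewrite big1 ?addr0 ?mulr1n // /x dE overlap0 if_same mul0r subr0 //.
have lteD : (e < D)%N by apply: ltnW; rewrite -dE.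
rewrite (bigD1 (Ordinal lteD)) //= eqxx big1 ?addr0.
  by rewrite !mulr1n subrK.
by move=> i; rewrite -val_eqE eqSS => /negPf /= ->.
Qed.

Lemma tetris_neq0 j i : tetris j i != 0 ->
  (start i <= j < start i.+1)%N \/
  (start i.+1 <= j <= (start i.+1).+1)%N.
Proof.
rewrite /tetris -block_eq; have [->|_] := eqVneq i (block j); first by left.
case: ifP => [/andP[/eqP ib jb] _|]; last by rewrite eqxx.
right; rewrite ib jb andbT.
have /andP[] // : (start (block j) <= j < start (block j).+1)%N.
by rewrite -block_eq.
Qed.

(* This is why the vectors [n], [n + N], [n + 2N], ... can serve as an
   orthonormal basis of the [n]-th subspace. *)
Lemma tetris_disjoint j j' i : (j + N <= j')%N -> tetris j i * tetris j' i = 0.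
Proof.
move=> le_jj'; apply/eqP; apply/negPn/negP.
rewrite mulf_eq0 negb_or => /andP[/tetris_neq0 ji /tetris_neq0 ji'].
have startb := start_bounds i; have startb1 := start_bounds i.+1.
have le_start := startS i.
(* Both indices lie between [start i] and [(start i.+1).+1]. Multiplying by D and using
   [start_bounds] yields DN < 2D + NR, whereas 2D <= NR <= DN/2. *)
have : (start i + N <= (start i.+1).+1)%N by lia.
have : (D * start i.+1 <= D * start i + D + N * R)%N by lia.
nia.
Qed.

Lemma orthonormal_frames_tetris : orthonormal_frames K D N R.
Proof.
apply: (orthonormal_frames_of_rows _ _ _ _ tetris).
- exact: sum_sqr_tetris.
- by move=> j j' i le_jj' _; exact: tetris_disjoint.
- exact: sum_tetris.
Qed.
End SpectralTetris.

(** * Orbits *)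

Section OrbitReduction.
Variables (K : realType) (N : nat).
Hypothesis N_gt1 : (1 < N)%N.

Definition TFF_condition (D R : nat) : Prop :=
  0 <= ftff D%:Z N%:Z R%:Z \/
  exists D0 R0 : K,
    [/\ Orb (D%:R, N%:R, R%:R) (D0, N%:R, R0), 0 < R0 &
        R0 = D0 / N%:R \/ R0 = D0].

Lemma nuK : involutive (@nu K).
Proof. by move=> [[D n] R] /=; rewrite opprB addrC subrK. Qed.

Lemma sigmaK : involutive (@sigma K).
Proof. by move=> [[D n] R] /=; rewrite opprB addrC subrK. Qed.

Lemma Orb_refl (x : K * K * K) : Orb x x.
Proof. by exists id => //; exact: gen_id. Qed.

Lemma Orb_nu (x y : K * K * K) : Orb (nu x) y -> Orb x y.
Proof.
move=> [g gen_g ->]; exists (g \o @nu K) => //; apply: gen_comp => //.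
by apply: gen_incl; left.
Qed.

Lemma Orb_sigma (x y : K * K * K) : Orb (sigma x) y -> Orb x y.
Proof.
move=> [g gen_g ->]; exists (g \o @sigma K) => //; apply: gen_comp => //.
by apply: gen_incl; right.
Qed.

(** One-sided stability gives an equivalence because the generators are involutions; the equivalence
    is what passes through inverses in the induction. *)
Lemma Orb_stable (P : K * K * K -> Prop) x y :
  (forall z, P z -> P (nu z)) -> (forall z, P z -> P (sigma z)) ->
  Orb x y -> P x <-> P y.
Proof.
move=> Pnu Psigma [g gen_g ->].
elim: {g} gen_g x => [g gP|x|g h _ IHg _ IHh x|g h _ IHg _ hK x].
- move=> x; case: gP => ->; split; [exact: Pnu| |exact: Psigma|].
    by rewrite -{2}[x]nuK; exact: Pnu.
  by rewrite -{2}[x]sigmaK; exact: Psigma.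
- by [].
- by rewrite (IHh x) (IHg (h x)).
- by rewrite (IHg (h x)) hK.
Qed.

Lemma TFF_condition_nu D R : (D <= N * R)%N ->
  TFF_condition (N * R - D) R -> TFF_condition D R.
Proof.
move=> leD [f_ge0|[D0 [R0 [orb R0_gt0 R0E]]]]; [left|right].
  by move: f_ge0; rewrite /ftff -subzn // PoszM; congr (_ <= _); ring.
exists D0, R0; split=> //; apply: Orb_nu.
by move: orb; rewrite natrB // natrM.
Qed.

Lemma TFF_condition_sigma D R : (R <= D)%N ->
  TFF_condition D (D - R) -> TFF_condition D R.
Proof.
move=> leR [f_ge0|[D0 [R0 [orb R0_gt0 R0E]]]]; [left|right].
  by move: f_ge0; rewrite /ftff -subzn //; congr (_ <= _); ring.
exists D0, R0; split=> //; apply: Orb_sigma.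
by move: orb; rewrite natrB.
Qed.

(** [T] abstracts the existence of frames: it is taken with doubled D and R for necessity and with D
    and R themselves for sufficiency. *)
Variable T : nat -> nat -> Prop.
Hypothesis T_leq : forall D R, (0 < D)%N -> (0 < R)%N -> T D R ->
  (R <= D <= N * R)%N.
Hypothesis T_nu : forall D R, (0 < D)%N -> (0 < R)%N -> (D < N * R)%N ->
  T D R -> T (N * R - D) R.
Hypothesis T_sigma : forall D R, (0 < D)%N -> (0 < R)%N -> (R < D)%N ->
  T D R -> T D (D - R).

Lemma TFF_condition_necessary D R : (0 < D)%N -> (0 < R)%N -> T D R ->
  TFF_condition D R.
Proof.
have [m] := ubnP (D + R); elim: m D R => // m IHm D R ltm D_gt0 R_gt0 TDR.
have /andP[leRD leDNR] := T_leq _ _ D_gt0 R_gt0 TDR.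
have N_neq0 : N%:R != 0 :> K by rewrite pnatr_eq0 -lt0n ltnW.
have [eqRD|neqRD] := eqVneq R D.
  right; exists D%:R, R%:R; split; first exact: Orb_refl.
    by rewrite ltr0n.
  by right; rewrite eqRD.
have [eqDNR|neqDNR] := eqVneq D (N * R)%N.
  right; exists D%:R, R%:R; split; first exact: Orb_refl.
    by rewrite ltr0n.
  by left; rewrite eqDNR natrM mulrC mulKf.
have ltRD : (R < D)%N by rewrite ltn_neqAle neqRD.
have ltDNR : (D < N * R)%N by rewrite ltn_neqAle neqDNR.
case: (ltnP D (2 * R)) => [ltD2R|le2RD].
  apply: TFF_condition_sigma => //; apply: IHm => //; try lia.
  exact: T_sigma.
case: (ltnP (N * R) (2 * D)) => [ltNR2D|le2DNR].
  apply: TFF_condition_nu => //; apply: IHm => //; try lia.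
  exact: T_nu.
(* Both summands of 2f = D(NR-2D) + NR(D-2R) are now nonnegative. *)
by left; rewrite /ftff; nia.
Qed.

Hypothesis T_full : forall R, (0 < R)%N -> T R R.
Hypothesis T_basis : forall R, (0 < R)%N -> T (N * R)%N R.
Hypothesis T_tetris : forall D R, (0 < D)%N -> (0 < R)%N ->
  (2 * R <= D)%N -> (2 * D <= N * R)%N -> T D R.

Lemma T_of_ftff_ge0 D R : (0 < D)%N -> (0 < R)%N ->
  0 <= ftff D%:Z N%:Z R%:Z -> T D R.
Proof.
have [m] := ubnP (D + R); elim: m D R => // m IHm D R ltm D_gt0 R_gt0 f_ge0.
(* As f = NR(D-R) - D^2 = D(NR-D) - NR^2, the condition f >= 0 keeps both complements
   nondegenerate. *)
have ltRD : (R < D)%N by move: f_ge0; rewrite /ftff; nia.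
have ltDNR : (D < N * R)%N by move: f_ge0; rewrite /ftff; nia.
case: (ltnP D (2 * R)) => [ltD2R|le2RD].
  rewrite -[R](subKn (ltnW ltRD)); apply: T_sigma; try lia.
  apply: IHm; try lia.
  by move: f_ge0; rewrite /ftff -subzn ?(ltnW ltRD) //; congr (_ <= _); ring.
case: (ltnP (N * R) (2 * D)) => [ltNR2D|le2DNR]; last exact: T_tetris.
rewrite -[D](subKn (ltnW ltDNR)); apply: T_nu; try lia.
apply: IHm; try lia.
move: f_ge0; rewrite /ftff -subzn ?(ltnW ltDNR) // PoszM.
by congr (_ <= _); ring.
Qed.

Let integral_triple (x : K * K * K) : Prop :=
  exists d r : int, x = (d%:~R, N%:R, r%:~R).

(* The orbit of a point with [T D R] can leave the cone [R <= D <= N R] only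
   through an axis, beyond which it is repeated with opposite signs. *)
Let signed_T (x : K * K * K) : Prop :=
  exists (D R : nat) (e : K),
    x = (e * D%:R, N%:R, e * R%:R) /\ (e = 1 \/ e = -1) /\
    [\/ D = 0%N, R = 0%N | T D R].

(** The axis D = 0 is sent to D = NR, where [T_basis] applies, and back; on the axis R = 0 only the
    sign changes. For [sigma] the axes exchange roles, with [T_full] on R = D. *)
Lemma signed_T_nu x : signed_T x -> signed_T (nu x).
Proof.
move=> [D [R [e [-> [eP TDR]]]]] /=.
have [D0|D_gt0] := posnP D.
  exists (N * R)%N, R, e; split; [by rewrite D0 natrM; congr (_, _, _); ring|].
  by split=> //; case: (posnP R) => [->|/T_basis]; [apply: Or32|apply: Or33].
have [R0|R_gt0] := posnP R.
  exists D, 0%N, (- e); split; [by rewrite R0; congr (_, _, _); ring|].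
  by split; [case: eP => ->; rewrite ?opprK; [right|left]|apply: Or32].
have {}TDR : T D R by case: TDR => // ?; lia.
have /andP[_ leDNR] := T_leq _ _ D_gt0 R_gt0 TDR.
exists (N * R - D)%N, R, e; split; [|split=> //].
  by rewrite natrB // natrM; congr (_, _, _); ring.
have [ltDNR|geDNR] := ltnP D (N * R); last by apply: Or31; lia.
by apply: Or33; apply: T_nu.
Qed.

Lemma signed_T_sigma x : signed_T x -> signed_T (sigma x).
Proof.
move=> [D [R [e [-> [eP TDR]]]]] /=.
have [D0|D_gt0] := posnP D.
  exists 0%N, R, (- e); split; [by rewrite D0; congr (_, _, _); ring|].
  by split; [case: eP => ->; rewrite ?opprK; [right|left]|apply: Or31].
have [R0|R_gt0] := posnP R.
  exists D, D, e; split; [by rewrite R0; congr (_, _, _); ring|].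
  by split=> //; apply: Or33; exact: T_full.
have {}TDR : T D R by case: TDR => // ?; lia.
have /andP[leRD _] := T_leq _ _ D_gt0 R_gt0 TDR.
exists D, (D - R)%N, e; split; [|split=> //].
  by rewrite natrB //; congr (_, _, _); ring.
have [ltRD|geRD] := ltnP R D; last by apply: Or32; lia.
by apply: Or33; apply: T_sigma.
Qed.

(** In the orbit case, [signed_T] holds at the special point by [T_full] or [T_basis] and is carried
    back along the orbit. *)
Lemma TFF_condition_sufficient D R : (0 < D)%N -> (0 < R)%N ->
  TFF_condition D R -> T D R.
Proof.
move=> D_gt0 R_gt0 [|[D0 [R0 [orb R0_gt0 R0E]]]]; first exact: T_of_ftff_ge0.
(* A priori [D0] and [R0] are mere elements of [K]; the orbit makes them integers. *)
have [d [r [D0d R0r]]] : integral_triple (D0, N%:R, R0).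
  apply/(Orb_stable integral_triple _ _ _ _ orb); last by exists D%:Z, R%:Z.
  - move=> _ [d [r ->]]; exists (N%:Z * r - d), r.
    by rewrite /= rmorphB rmorphM.
  - by move=> _ [d [r ->]]; exists d, (d - r); rewrite /= rmorphB.
have N_neq0 : N%:R != 0 :> K by rewrite pnatr_eq0 -lt0n ltnW.
case: r R0r => [r|r] R0r; last by move: R0_gt0; rewrite R0r ltr0z.
have r_gt0 : (0 < r)%N by move: R0_gt0; rewrite R0r ltr0n.
have : signed_T (D0, N%:R, R0).
  case: R0E => R0D; last first.
    exists r, r, 1; split; first by rewrite -R0D R0r mul1r.
    by split; [left|apply: Or33; exact: T_full].
  exists (N * r)%N, r, 1; split.
    have -> : D0 = N%:R * R0 by rewrite R0D mulrC divfK.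
    by rewrite R0r !mul1r natrM.
  by split; [left|apply: Or33; exact: T_basis].
move=> /(Orb_stable signed_T _ _ signed_T_nu signed_T_sigma orb).
move=> [D' [R' [e [[DE RE] [eP TDR]]]]].
(* Positivity of D and R rules out the negative sign and both axes. *)
have e1 : e = 1.
  case: eP => // eN1; have : 0 < D%:R :> K by rewrite ltr0n.
  by rewrite DE eN1 mulN1r oppr_gt0 ltrn0.
move: DE RE; rewrite e1 !mul1r => /eqP; rewrite eqr_nat => /eqP DE.
move=> /eqP; rewrite eqr_nat => /eqP RE.
by case: TDR; rewrite -?DE -?RE // => ?; lia.
Qed.

End OrbitReduction.

(** * From subspaces to matrices and back *)

Section AbstractProjection.
Variables (K : realType) (H : vectType K[i]) (form : {dot H for Num.conj}).

Lemma capv_orthov (U : {vspace H}) : (U :&: orthov form U = 0)%VS.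
Proof.
apply/eqP; rewrite -subv0; apply/subvP => u; rewrite memv_cap memv0.
by case/andP=> uU /mem_orthovP /(_ u uU) /eqP; rewrite dnorm_eq0.
Qed.

Lemma orthoproj_eq (U : {vspace H}) u w :
  w \in U -> u - w \in orthov form U -> orthoproj form U u = w.
Proof.
move=> wU uwU; have cap0 := capv_orthov U.
have proj0 : orthoproj form U (u - w) = 0.
  have uw_add : u - w \in (U + orthov form U)%VS.
    by rewrite (subvP (addvSr _ _)).
  have := daddv_pi_add cap0 uw_add.
  rewrite [X in _ + X]daddv_pi_id // 1?capvC //.
  by rewrite -[RHS]add0r => /addIr.
rewrite -[u](subrK w) linearD /= proj0 add0r.
exact: daddv_pi_id.
Qed.
End AbstractProjection.

Section OrthonormalBasis.
Variables (K : realType) (H : vectType K[i]) (form : {dot H for Num.conj}).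

(** Gram-Schmidt: the component [Z] of [x] orthogonal to [S] is normalized and added, unless it is
    zero. *)
Lemma exists_orthonormal_span (X : seq H) :
  exists2 S, orthonormal form S & (<<S>> = <<X>>)%VS.
Proof.
elim: X => [|x X [S onS SX]]; first by exists [::].
have [Y SY [Z [xE _ ZS]]] := orthogonal_split form S x.
rewrite span_cons -SX.
have [Z0|Z_neq0] := eqVneq Z 0.
  exists S => //; apply/esym/eqP.
  by rewrite (sameP eqP addv_idPr) -memvE xE Z0 addr0.
pose c := (sqrtC (form Z Z))^-1.
have c_neq0 : c != 0 by rewrite invr_eq0 sqrt_dnorm_eq0.
exists (c *: Z :: S).
  rewrite -cat1s orthonormal_cat onS; apply/and3P; split=> //.
    rewrite /orthonormal /= !andbT dnormZ normfV ger0_norm ?sqrt_dnorm_ge0 //.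
    by rewrite exprVn sqrtCK mulVf ?dnorm_eq0.
  by apply/orthoPl => s sS; rewrite linearZl_LR /= (orthoPl ZS) ?mulr0.
rewrite span_cons; apply/eqP; rewrite eqEsubv !subv_add !addvSr !andbT.
rewrite -!memvE xE; apply/andP; split.
  rewrite memvZ // -{1}[Z](addKr Y) addrC; apply: memvB.
    by rewrite (subvP (addvSl _ _)) ?memv_line.
  exact: subvP (addvSr _ _) _ SY.
rewrite addrC memv_add // -{1}[Z](scalerK c_neq0).
by apply: memvZ; exact: memv_line.
Qed.

Lemma exists_orthonormal_basis (U : {vspace H}) n : \dim U = n ->
  exists2 e : 'I_n -> H, (forall i j, form (e i) (e j) = (i == j)%:R) &
    forall u, orthoproj form U u = \sum_i form u (e i) *: e i.
Proof.
move=> dimU; have [S onS SU] := exists_orthonormal_span (vbasis U).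
rewrite (span_basis (vbasisP U)) in SU.
have szS : size S = n.
  by have := orthonormal_free onS; rewrite /free SU dimU => /eqP.
have /orthonormalP[uniqS onSE] := onS.
exists (fun i => S`_i) => [i j|u].
  by rewrite onSE ?mem_nth ?szS // nth_uniq ?szS.
apply: orthoproj_eq.
  apply: memv_suml => i _; rewrite memvZ // -SU memv_span // mem_nth //.
  by rewrite szS.
rewrite -SU; set w := \sum_i _.
have : orthogonal form [:: u - w] S.
  apply/orthoPl => s sS; rewrite linearBl linear_sumlz /=.
  have ltS : (index s S < n)%N by rewrite -szS index_mem.
  rewrite (bigD1 (Ordinal ltS)) //= nth_index // linearZl_LR /= (onSE s s) //.
  rewrite eqxx mulr1 big1 ?addr0 ?subrr // => i.
  rewrite -val_eqE /= => ne_i.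
  rewrite linearZl_LR /= (onSE _ s) ?mem_nth ?szS //.
  rewrite -[s in _ == s](nth_index 0 sS) nth_uniq ?szS ?index_mem //.
  by rewrite (negPf ne_i) mulr0.
by rewrite orthogonalE span_seq1 -memvE.
Qed.
End OrthonormalBasis.

Lemma real_TFF_of_frames (K : realType) (D N R : nat) :
  (0 < D)%N -> (0 < N)%N -> (0 < R)%N ->
  orthonormal_frames K D N R -> real_TFF_exists K D N R.
Proof.
move=> D_gt0 N_gt0 R_gt0 [V [VVT sumV]].
pose Vc n : 'M[K[i]]_(R, D) := map_mx (real_complex K) (V n).
have VcVcT n : Vc n *m (Vc n)^T = 1%:M.
  by rewrite map_trmx -map_mxM VVT map_mx1.
have Vc_conj n : map_mx Num.conj (Vc n)^T = (Vc n)^T.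
  by apply/matrixP => i j; rewrite !mxE; exact: conjc_real.
pose U n : {vspace 'rV[K[i]]_D} := limg (linfun (mulmxr (Vc n))).
have memU n x : x *m Vc n \in U n.
  by rewrite -[x *m _](lfunE (mulmxr (Vc n))) memv_img ?memvf.
have projE n x : orthoproj (@dotmx _ D) (U n) x = x *m ((Vc n)^T *m Vc n).
  apply: orthoproj_eq; first by rewrite mulmxA.
  apply/mem_orthovP => _ /memv_imgP[y _ ->].
  have xV : (x - x *m ((Vc n)^T *m Vc n)) *m (Vc n)^T = 0.
    by rewrite mulmxBl -!mulmxA VcVcT mulmx1 subrr.
  rewrite lfunE /= dotmxE trmx_mul map_mxM Vc_conj.
  by have -> := mulmxA _ _ (map_mx Num.conj y^T); rewrite xV mul0mx mxE.
have tffU : is_TFF (@dotmx _ D) D R U.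
  split.
  - by rewrite dimvf /dim /= mul1n.
  - move=> n; rewrite limg_dim_eq ?dimvf /dim /= ?mul1n //.
    apply/eqP; rewrite -subv0; apply/subvP => y.
    rewrite memv_cap memv_ker lfunE /= => /andP[_ /eqP yV].
    by rewrite -[y]mulmx1 -(VcVcT n) mulmxA yV mul0mx mem0v.
  exists ((N * R)%:R / D%:R); first by rewrite divr_gt0 ?ltr0n ?muln_gt0 ?N_gt0.
  apply/lfunP => x; rewrite sum_lfunE scale_lfunE id_lfunE.
  under eq_bigr do rewrite projE /Vc map_trmx -map_mxM.
  rewrite -mulmx_sumr -map_mx_sum.
  have -> : \sum_n (V n)^T *m V n = ((N * R)%:R / D%:R)%:M.
    rewrite mulrC -scale_scalar_mx -sumV scalerA mulVf ?scale1r //.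
    by rewrite pnatr_eq0 -lt0n.
  by rewrite map_scalar_mx mul_mx_scalar.
exists 'rV[K[i]]_D, (@dotmx _ D), U; split=> //.
(* The projections already have real matrices in the standard basis. *)
exists \1%VF; first by split; [move=> u v; rewrite !id_lfunE|exact: lim1g].
move=> n; apply/mxOverP => i j; rewrite mxE.
rewrite !comp_lfunE id_lfunE.
have -> x : ((\1 : 'End('rV[K[i]]_D))^-1)%VF x = x.
  by rewrite -[RHS](limg_lfunVK (f := \1%VF)) ?lim1g ?memvf // id_lfunE.
rewrite projE /Vc map_trmx -map_mxM -rowE !mxE.
by apply/complex_realP; eexists.
Qed.

(** The blockwise form of the embedding of a + bi as the real matrix with rows (a, b) and (-b, a).
    It turns adjoints into transposes, hence preserves orthonormality of rows and tightness. *)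
Definition realify (K : realType) m n (A : 'M[K[i]]_(m, n)) :
    'M[K]_(m + m, n + n) :=
  block_mx (map_mx (@complex.Re K) A) (map_mx (@complex.Im K) A)
    (- map_mx (@complex.Im K) A) (map_mx (@complex.Re K) A).

Section Realify.
Variable K : realType.

Lemma realifyM m n p (A : 'M[K[i]]_(m, n)) (B : 'M[K[i]]_(n, p)) :
  realify K _ _ (A *m B) = realify K _ _ A *m realify K _ _ B.
Proof.
have ReM : map_mx (@complex.Re K) (A *m B) =
    map_mx (@complex.Re K) A *m map_mx (@complex.Re K) B -
    map_mx (@complex.Im K) A *m map_mx (@complex.Im K) B.
  apply/matrixP => i j; rewrite !mxE [LHS](raddf_sum (@complex.Re K)) -sumrB.
  by apply: eq_bigr => k _; rewrite !mxE; case: (A i k) (B k j) => ? ? [].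
have ImM : map_mx (@complex.Im K) (A *m B) =
    map_mx (@complex.Re K) A *m map_mx (@complex.Im K) B +
    map_mx (@complex.Im K) A *m map_mx (@complex.Re K) B.
  apply/matrixP => i j.
  rewrite !mxE [LHS](raddf_sum (@complex.Im K)) -big_split.
  by apply: eq_bigr => k _; rewrite !mxE; case: (A i k) (B k j) => ? ? [].
rewrite /realify mulmx_block ReM ImM !mulNmx !mulmxN.
by congr block_mx; rewrite // ?opprD addrC.
Qed.

Lemma realify_tr_conj m n (A : 'M[K[i]]_(m, n)) :
  realify K _ _ (map_mx Num.conj A^T) = (realify K _ _ A)^T.
Proof.
by rewrite /realify tr_block_mx; congr block_mx; apply/matrixP => i j;
  rewrite !mxE; case: (A j i) => x y /=; rewrite ?opprK.
Qed.

Lemma realify_sum m n (I : finType) (A : I -> 'M[K[i]]_(m, n)) :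
  realify K _ _ (\sum_i A i) = \sum_i realify K _ _ (A i).
Proof.
have realify_add : {morph realify K m n : B C / B + C}.
  move=> B C; rewrite /realify add_block_mx -opprD.
  by congr block_mx; try congr (- _); apply/matrixP => i j;
    rewrite !mxE; case: (B i j) (C i j) => ? ? [].
apply: (big_morph _ realify_add); rewrite /realify.
have z f : f 0 = 0 -> map_mx f (0 : 'M[K[i]]_(m, n)) = 0 :> 'M[K]_(m, n).
  by move=> f0; apply/matrixP => i j; rewrite !mxE.
by rewrite !z // oppr0 block_mx_const.
Qed.

Lemma realify_scalar n (a : K) : realify K n n (real_complex K a)%:M = a%:M.
Proof.
rewrite /realify scalar_mx_block; congr block_mx;
  apply/matrixP => i j; rewrite !mxE; case: (_ == _) => //=; exact: oppr0.
Qed.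

Lemma orthonormal_frames_of_complex D N R
    (V : 'I_N -> 'M[K[i]]_(R, D)) (a : K) :
  (forall n, V n *m map_mx Num.conj (V n)^T = 1%:M) ->
  \sum_n map_mx Num.conj (V n)^T *m V n = (real_complex K a)%:M ->
  orthonormal_frames K (D + D) N (R + R).
Proof.
move=> VV sumV.
have VVr n : realify K _ _ (V n) *m (realify K _ _ (V n))^T = 1%:M.
  rewrite -realify_tr_conj -realifyM VV -[1]/(real_complex K 1).
  exact: realify_scalar.
exists (fun n => realify K _ _ (V n)); split=> //.
have sumE : \sum_n (realify K _ _ (V n))^T *m realify K _ _ (V n) = a%:M.
  under eq_bigr do rewrite -realify_tr_conj -realifyM.
  by rewrite -realify_sum sumV realify_scalar.
rewrite sumE scale_scalar_mx; congr _%:M.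
(* Traces determine [a]: a(D + D) = N(R + R). *)
have := congr1 mxtrace sumE; rewrite raddf_sum /= mxtrace_scalar.
under eq_bigr do rewrite mxtrace_mulC VVr mxtrace1.
rewrite sumr_const card_ord -[_ *+ N]mulr_natl -natrM => ->.
exact: mulr_natl.
Qed.
End Realify.

Lemma orthonormal_frames_of_TFF (K : realType) D N R :
  TFF_exists K D N R -> orthonormal_frames K (D + D) N (R + R).
Proof.
move=> [H [form [U [dimH dimU [a _ sumU]]]]].
have [e eE projH] := exists_orthonormal_basis K H form _ _ dimH.
have eU u : u = \sum_i form u (e i) *: e i.
  by rewrite -projH; apply/esym/orthoproj_eq; rewrite ?memvf // subrr mem0v.
(* An orthonormal basis of every [U n] is chosen at once; [V n] will hold its coordinates in the
   basis [e] of [H]. *)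
have [f fE] := fin_all_exists (fun n =>
  let: ex_intro2 f fE projU := exists_orthonormal_basis K H form _ _ (dimU n) in
  ex_intro (fun f : 'I_R -> H =>
    (forall k l, form (f k) (f l) = (k == l)%:R) /\
    (forall u, orthoproj form (U n) u = \sum_k form u (f k) *: f k))
    f (conj fE projU)).
have form_conj u v : Num.conj (form u v) = form v u.
  by rewrite [in RHS]hermC expr0 mul1r.
apply: (orthonormal_frames_of_complex _ _ _ _
  (fun n => \matrix_(k, i) form (f n k) (e i)) a) => [n|].
  apply/matrixP => k l; rewrite !mxE -(fE n).1 [in RHS](eU (f n l)) linear_sumr.
  by apply: eq_bigr => i _; rewrite !mxE linearZr_LR /= mulrC.
apply/matrixP => i j; rewrite summxE.
(* The (i, j) entry is the matrix coefficient of the sum of the projections. *)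
transitivity (form (\sum_n orthoproj form (U n) (e i)) (e j)).
  rewrite linear_sumlz; apply: eq_bigr => n _.
  rewrite (fE n).2 linear_sumlz mxE; apply: eq_bigr => k _.
  by rewrite !mxE linearZl_LR /= form_conj.
rewrite -sum_lfunE sumU scale_lfunE id_lfunE linearZl_LR /= eE !mxE.
by rewrite mulr_natr.
Qed.

Theorem theorem5p1 (K : realType) (D N R : nat)
    (D_gt0 : (0 < D)%N) (N_gt1 : (1 < N)%N) (R_gt0 : (0 < R)%N) :
  (TFF_exists K D N R <->
     0 <= ftff D%:Z N%:Z R%:Z \/
     exists D0 R0 : K,
       [/\ Orb (D%:R, N%:R, R%:R) (D0, N%:R, R0),
           0 < R0 &
           R0 = D0 / N%:R \/ R0 = D0]) /\
  (TFF_exists K D N R -> real_TFF_exists K D N R).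
Proof.
have N_gt0 : (0 < N)%N := ltnW N_gt1.
have necessary : TFF_exists K D N R -> TFF_condition K N D R.
  move=> /orthonormal_frames_of_TFF.
  (* Both complements are linear in (D, R), so they commute with the doubling due to
     realification. *)
  apply: (TFF_condition_necessary _ _ N_gt1
    (fun D R => orthonormal_frames K (D + D) N (R + R))) => // d r d_gt0 r_gt0.
  - move=> /orthonormal_frames_leq; rewrite addn_gt0 r_gt0.
    by move=> /(_ N_gt0 isT); lia.
  - move=> lt_d_Nr.
    have -> : (N * r - d + (N * r - d) = N * (r + r) - (d + d))%N by lia.
    by apply: orthonormal_frames_nu; lia.
  - move=> lt_r_d; have -> : (d - r + (d - r) = d + d - (r + r))%N by lia.
    by apply: orthonormal_frames_sigma; lia.
have sufficient : TFF_condition K N D R -> real_TFF_exists K D N R.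
  move=> cond; apply: real_TFF_of_frames => //; move: cond.
  apply: (TFF_condition_sufficient _ _ N_gt1
    (fun D R => orthonormal_frames K D N R)) => //.
  - by move=> d r d_gt0 r_gt0 /orthonormal_frames_leq; apply.
  - by move=> d r d_gt0 r_gt0; exact: orthonormal_frames_nu.
  - by move=> d r d_gt0 r_gt0; exact: orthonormal_frames_sigma.
  - by move=> r r_gt0; exact: orthonormal_frames_full.
  - by move=> r r_gt0; exact: orthonormal_frames_basis.
  - by move=> d r d_gt0 r_gt0; exact: orthonormal_frames_tetris.
split; last by move=> /necessary/sufficient.
split=> // /sufficient [H [form [U [tffU _]]]].
by exists H, form, U.
Qed.
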